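(* There exists a universal constant $K>0$ such that the following holds. Let $q$ be a probability distribution on $[d]$, write $\gamma=\min\{q(j):j\in[d]\}$, and let $\theta\ge 0$. If $T\ge K\cdot\max\{\frac{\sqrt d}{\theta},\frac{1}{\sqrt{\theta\gamma}}\}$, then there is an algorithm which, given $c=2$ independent samples from each of (unknown) probability distributions $p_1,\dots,p_T$ on $[d]$ (all samples mutually independent), distinguishes with probability at least $0.99$ the case $\chi^2(p_{\mathrm{avg}}\,\|\,q)\le 0.99\,\theta$ from the case $\chi^2(p_{\mathrm{avg}}\,\|\,q)>\theta$, where $p_{\mathrm{avg}}=\frac1T\sum_{t=1}^Tp_t$.
   Context: $\chi^2(p\,\|\,q)=\sum_{j=1}^d\frac{(p(j)-q(j))^2}{q(j)}=\sum_{j=1}^d\frac{p(j)^2}{q(j)}-1$ is the $\chi^2$-divergence. ''Distinguishes with probability at least $0.99$'' means: the algorithm (which may depend on $d,q,\theta,T$ but not on the $p_t$) outputs accept/reject, accepting with probability at least $0.99$ in the first case and rejecting with probability at least $0.99$ in the second case. *)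

(* Defs.v *)
From HB Require Import structures.
From mathcomp Require Import all_boot all_order all_algebra.
From mathcomp Require Import Rstruct.
From Stdlib Require Import Rdefinitions.
Set Implicit Arguments. Unset Strict Implicit. Unset Printing Implicit Defensive.
Import Order.TTheory GRing.Theory Num.Theory.
Local Open Scope ring_scope.

Definition is_distr (d : nat) (p : 'I_d -> R) : Prop :=
  (forall j, 0 <= p j) /\ \sum_(j < d) p j = 1.

Definition chi2 (d : nat) (p q : 'I_d -> R) : R :=
  \sum_(j < d) (p j - q j) ^+ 2 / q j.

(* gamma = min_j q j  (for a distribution on a nonempty [d], every q j <= 1,
   so the neutral element 1 does not affect the minimum) *)
Definition minq (d : nat) (q : 'I_d -> R) : R :=
  \big[Num.min/1]_(j < d) q j.

Definition pavg (T d : nat) (p : 'I_T -> 'I_d -> R) : 'I_d -> R :=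
  fun j => (T%:R)^-1 * \sum_(t < T) p t j.

Definition sample_space (T d : nat) := {ffun 'I_T -> 'I_d * 'I_d}.

Definition sample_prob (T d : nat) (p : 'I_T -> 'I_d -> R)
    (x : sample_space T d) : R :=
  \prod_(t < T) (p t (x t).1 * p t (x t).2).

(* A (possibly randomized) test: maps an outcome to its acceptance
   probability in [0,1]. *)
Definition is_test (T d : nat) (A : sample_space T d -> R) : Prop :=
  forall x, 0 <= A x <= 1.

Definition accept_prob (T d : nat) (A : sample_space T d -> R)
    (p : 'I_T -> 'I_d -> R) : R :=
  \sum_(x : sample_space T d) sample_prob p x * A x.

(* Main.v *)
Require Import Defs.
From HB Require Import structures.
From mathcomp Require Import all_boot all_order all_algebra.
From mathcomp Require Import Rstruct ring lra.
From Stdlib Require Import Rdefinitions.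
Set Implicit Arguments. Unset Strict Implicit. Unset Printing Implicit Defensive.
Import Order.TTheory GRing.Theory Num.Theory.
Local Open Scope ring_scope.

(** Use the first sample of each [p_t] to form a count vector [N], the second to
    form an independent count vector [N'], and threshold
      [Z = \sum_j (N j - T q j) (N' j - T q j) / q j]
    at [(199/200) T^2 theta].  With [m] the average distribution and
    [r = (m - q) / q], the mean of [Z] is [T^2 chi2 m q], and conditioning on
    [N] bounds its variance by
      [T^2 \sum_j (1 + r j)^2 + 2 T^3 \sum_j m j r j^2].
    As [q j r j^2 <= chi2 m q] for every [j], both sums are controlled by
    [chi2 m q] and [1 / gamma], and Chebyshev's inequality at distance
    [T^2 max(theta, chi2 m q) / 200] concludes. *)

(** * Moments under independent, not necessarily identical, coordinates *)

Section ProductExpectation.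
Variables (F : realFieldType) (I J : finType).
Implicit Types (w : I -> J -> F) (f g : {ffun I -> J} -> F).

Definition prod_expect w f : F := \sum_(x : {ffun I -> J}) (\prod_i w i (x i)) * f x.

Lemma eq_prod_expect w f g : f =1 g -> prod_expect w f = prod_expect w g.
Proof. by move=> fg; apply: eq_bigr => x _; rewrite fg. Qed.

Lemma prod_expectD w f g :
  prod_expect w (fun x => f x + g x) = prod_expect w f + prod_expect w g.
Proof. by rewrite -big_split; apply: eq_bigr => x _; rewrite mulrDr. Qed.

Lemma prod_expectZ w a f : prod_expect w (fun x => a * f x) = a * prod_expect w f.
Proof. by rewrite mulr_sumr; apply: eq_bigr => x _; rewrite mulrCA. Qed.

Lemma prod_expect_sum w (K : finType) (f : K -> {ffun I -> J} -> F) :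
  prod_expect w (fun x => \sum_k f k x) = \sum_k prod_expect w (f k).
Proof. by rewrite exchange_big; apply: eq_bigr => x _; rewrite mulr_sumr. Qed.

Lemma le_prod_expect w f g : (forall i j, 0 <= w i j) ->
  (forall x, f x <= g x) -> prod_expect w f <= prod_expect w g.
Proof.
move=> w0 fg; apply: ler_sum => x _.
by apply: ler_wpM2l (fg x); apply: prodr_ge0.
Qed.

Lemma prod_expect_prod w (h : I -> J -> F) :
  prod_expect w (fun x => \prod_i h i (x i)) = \prod_i \sum_j w i j * h i j.
Proof. by rewrite bigA_distr_bigA; apply: eq_bigr => x _; rewrite big_split. Qed.

Section Normalized.
Variable w : I -> J -> F.
Hypothesis w1 : forall i, \sum_j w i j = 1.

Lemma prod_expect_marginal i (h : J -> F) :
  prod_expect w (fun x => h (x i)) = \sum_j w i j * h j.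
Proof.
pose H k j := if k == i then h j else 1.
transitivity (prod_expect w (fun x => \prod_k H k (x k))).
  apply: eq_prod_expect => x; rewrite (bigD1 i) //= /H eqxx big1 ?mulr1 //.
  by move=> k /negPf ->.
rewrite prod_expect_prod (bigD1 i) //= /H eqxx [X in _ * X]big1 ?mulr1 // => k /negPf ->.
by rewrite -[RHS](w1 k); apply: eq_bigr => j _; rewrite mulr1.
Qed.

Lemma prod_expect_const c : prod_expect w (fun=> c) = c.
Proof. by rewrite /prod_expect -mulr_suml -bigA_distr_bigA big1 ?mul1r. Qed.

(** Independence makes the expectation a product over coordinates, and the factor at [i] is zero.
    This removes the cross terms of a variance. *)
Lemma prod_expect_mul0 i k (h h' : J -> F) : i != k ->
  \sum_j w i j * h j = 0 -> prod_expect w (fun x => h (x i) * h' (x k)) = 0.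
Proof.
move=> ik h0.
pose H l j := if l == i then h j else if l == k then h' j else 1.
transitivity (prod_expect w (fun x => \prod_l H l (x l))).
  apply: eq_prod_expect => x.
  rewrite (bigD1 i) //= (bigD1 k) 1?eq_sym //= /H eqxx.
  rewrite (negPf (_ : k != i)) 1?eq_sym // eqxx big1 ?mulr1 //.
  by move=> l /andP[/negPf -> /negPf ->].
by rewrite prod_expect_prod (bigD1 i) //= /H eqxx h0 mul0r.
Qed.

(** Bias-variance decomposition: the variance of an independent sum is the sum of the variances,
    each at most a second moment. Dropping the squared means [mu i ^+ 2] leaves a bound linear in
    the laws [w i]. *)
Lemma prod_expect_sum_sqr (g : J -> F) c :
  prod_expect w (fun x => (\sum_i g (x i) - c) ^+ 2) <=
  \sum_i \sum_j w i j * g j ^+ 2 + (\sum_i \sum_j w i j * g j - c) ^+ 2.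
Proof.
pose mu i := \sum_j w i j * g j.
pose f i j := g j - mu i.
have f0 i : \sum_j w i j * f i j = 0.
  rewrite /f; under eq_bigr do rewrite mulrBr.
  by rewrite sumrB -mulr_suml w1 mul1r subrr.
set b := \sum_i mu i - c.
have -> : prod_expect w (fun x => (\sum_i g (x i) - c) ^+ 2) =
    prod_expect w (fun x => \sum_i \sum_k f i (x i) * f k (x k) +
      ((2 * b) * (\sum_i f i (x i)) + b ^+ 2)).
  apply: eq_prod_expect => x.
  have -> : \sum_i g (x i) - c = \sum_i f i (x i) + b.
    by rewrite /f sumrB /b; ring.
  by rewrite -big_distrlr /=; ring.
rewrite !prod_expectD prod_expectZ prod_expect_const !prod_expect_sum.
rewrite [X in 2 * b * X]big1; last by move=> i _; rewrite prod_expect_marginal.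
rewrite mulr0 add0r lerD2r; apply: ler_sum => i _.
rewrite prod_expect_sum (bigD1 i) //= [X in _ + X]big1 ?addr0; last first.
  by move=> k ki; apply: prod_expect_mul0 => //; rewrite eq_sym.
rewrite (prod_expect_marginal i (fun j => f i j * f i j)).
have -> : \sum_j w i j * (f i j * f i j) = \sum_j w i j * g j ^+ 2 - mu i ^+ 2.
  transitivity (\sum_j (w i j * g j ^+ 2 - (2 * mu i) * (w i j * g j)
                        + mu i ^+ 2 * w i j)).
    by apply: eq_bigr => j _; rewrite /f; ring.
  by rewrite big_split sumrB /= -!mulr_sumr w1 -/(mu i); ring.
by rewrite gerBl sqr_ge0.
Qed.

End Normalized.

(** Unzipping a vector of pairs is a bijection under which the weights factor. The first and second
    samples thus form two independent vectors, which permits conditioning on the first. *)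
Lemma prod_expect_pair (w : I -> J -> F) (f : {ffun I -> J} -> {ffun I -> J} -> F) :
  \sum_(z : {ffun I -> J * J}) (\prod_i (w i (z i).1 * w i (z i).2)) *
     f [ffun i => (z i).1] [ffun i => (z i).2] =
  prod_expect w (fun x => prod_expect w (f x)).
Proof.
under [RHS]eq_bigr do rewrite mulr_sumr.
rewrite pair_big /=.
pose h (xy : {ffun I -> J} * {ffun I -> J}) : {ffun I -> J * J} :=
  [ffun i => (xy.1 i, xy.2 i)].
rewrite (reindex h) /=; last first.
  exists (fun z => ([ffun i => (z i).1], [ffun i => (z i).2])) => [[x y] _|z _].
    by congr (_, _); apply/ffunP => i; rewrite !ffunE.
  by apply/ffunP => i; rewrite !ffunE; case: (z i).
apply: eq_bigr => -[x y] _ /=.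
have -> : [ffun i => (h (x, y) i).1] = x by apply/ffunP => i; rewrite !ffunE.
have -> : [ffun i => (h (x, y) i).2] = y by apply/ffunP => i; rewrite !ffunE.
by rewrite mulrA -big_split; congr (_ * _); apply: eq_bigr => i _; rewrite ffunE.
Qed.

End ProductExpectation.

(** * The bilinear statistic and its variance *)

Section Collision.
Variables (T d : nat) (q : 'I_d -> R).

Definition occurrences (x : {ffun 'I_T -> 'I_d}) (j : 'I_d) : R :=
  \sum_(t < T) (x t == j)%:R.

(* The statistic [Z]: the term [- T q j] of the second factor contributes nothing,
   since [occurrences x - T q] sums to zero. *)
Definition bilinear_stat (x y : {ffun 'I_T -> 'I_d}) : R :=
  \sum_(t < T) (occurrences x (y t) - T%:R * q (y t)) / q (y t).

Lemma sum_count (x : {ffun 'I_T -> 'I_d}) (g : 'I_d -> R) :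
  \sum_(j < d) g j * occurrences x j = \sum_(t < T) g (x t).
Proof.
under eq_bigr do rewrite mulr_sumr.
rewrite exchange_big; apply: eq_bigr => t _.
rewrite (bigD1 (x t)) //= eqxx mulr1 big1 ?addr0 // => j jx.
by rewrite eq_sym (negPf jx) mulr0.
Qed.

Hypotheses (q1 : is_distr q) (q0 : forall j, 0 < q j) (T0 : (0 < T)%nat).
Variable p : 'I_T -> 'I_d -> R.
Hypothesis p1 : forall t, is_distr (p t).

Let m := pavg p.
Let r j := (m j - q j) / q j.

Lemma sum_pavg (g : 'I_d -> R) :
  \sum_(t < T) \sum_(j < d) p t j * g j = T%:R * \sum_(j < d) m j * g j.
Proof.
rewrite exchange_big mulr_sumr; apply: eq_bigr => j _ /=.
rewrite -mulr_suml /m /pavg mulrA mulrA divff ?mul1r //.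
by rewrite pnatr_eq0 -lt0n.
Qed.

Lemma pavg_ge0 j : 0 <= m j.
Proof.
by rewrite mulr_ge0 ?invr_ge0 // sumr_ge0 // => t _; case: (p1 t) => + _; apply.
Qed.

Lemma pavg_sum1 : \sum_(j < d) m j = 1.
Proof.
rewrite -mulr_sumr exchange_big /= (eq_bigr (fun=> 1)); last first.
  by move=> t _; case: (p1 t).
by rewrite sumr_const card_ord mulVf // pnatr_eq0 -lt0n.
Qed.

Let q_neq0 j : q j != 0. Proof. by rewrite gt_eqF. Qed.

Lemma chi2_sum_sqr : chi2 m q = \sum_(j < d) q j * r j ^+ 2.
Proof. by apply: eq_bigr => j _; rewrite /r; field. Qed.

(** Since [m] and [q] both have total mass 1, [m - q] sums to zero and can be subtracted freely.
    Hence [\sum_t r (x t)] has mean [T * chi2 m q]. *)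
Lemma chi2_sum_dot : chi2 m q = \sum_(j < d) m j * r j.
Proof.
have [_ sq] := q1.
transitivity (\sum_(j < d) (m j * r j - (m j - q j))).
  by apply: eq_bigr => j _; rewrite /r; field.
by rewrite !sumrB pavg_sum1 sq subrr subr0.
Qed.

(** The second-moment bound is linear in the [p t], so only their average [m] survives. *)
Let sq_bound (g : 'I_d -> R) c :
  prod_expect p (fun x => (\sum_(t < T) g (x t) - c) ^+ 2) <=
  T%:R * (\sum_(j < d) m j * g j ^+ 2) +
    (T%:R * (\sum_(j < d) m j * g j) - c) ^+ 2.
Proof.
rewrite -!sum_pavg; apply: prod_expect_sum_sqr => t.
by case: (p1 t).
Qed.

Lemma bilinear_stat_variance :
  prod_expect p (fun x => prod_expect p (fun y =>
    (bilinear_stat x y - T%:R ^+ 2 * chi2 m q) ^+ 2)) <=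
  T%:R ^+ 2 * (\sum_(j < d) (1 + r j) ^+ 2) +
  2 * T%:R ^+ 3 * (\sum_(j < d) m j * r j ^+ 2).
Proof.
have p0 t j : 0 <= p t j by case: (p1 t) => + _; apply.
have [_ sq] := q1.
pose g (x : {ffun 'I_T -> 'I_d}) j := (occurrences x j - T%:R * q j) / q j.
(* The left side is the mean over [y] of the statistic for fixed [x]. As [m j / q j = 1 + r j], the
   total count [T] cancels the total of [T * m j]. *)
have gE x : T%:R * (\sum_(j < d) m j * g x j) = T%:R * \sum_(t < T) r (x t).
  congr (_ * _).
  transitivity (\sum_(j < d) (r j * occurrences x j + 1 * occurrences x j - T%:R * m j)).
    by apply: eq_bigr => j _; rewrite /g /r; field.
  rewrite sumrB big_split /= !sum_count -mulr_sumr pavg_sum1.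
  by rewrite sumr_const card_ord mulr1 addrK.
(* Given [x], the first summand bounds the conditional variance and the second is the squared
   deviation of the conditional mean. [B1] and [B2] average them over [x], each contributing one
   [T ^+ 3] term. *)
apply: (@le_trans _ _ (prod_expect p (fun x =>
   T%:R * (\sum_(j < d) m j / q j ^+ 2 * (\sum_(t < T) (x t == j)%:R - T%:R * q j) ^+ 2)
   + T%:R ^+ 2 * (\sum_(t < T) r (x t) - T%:R * chi2 m q) ^+ 2))).
  apply: le_prod_expect => // x.
  apply: le_trans (sq_bound (g x) _) _.
  rewrite gE le_eqVlt; apply/orP; left; apply/eqP; congr (_ * _ + _).
    by apply: eq_bigr => j _; rewrite /g /occurrences; field.
  by ring.
rewrite prod_expectD !prod_expectZ prod_expect_sum.
have B1 : \sum_(j < d) prod_expect p (fun x : {ffun 'I_T -> 'I_d} =>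
    m j / q j ^+ 2 * (\sum_(t < T) (x t == j)%:R - T%:R * q j) ^+ 2) <=
    \sum_(j < d) (T%:R * (1 + r j) ^+ 2 + T%:R ^+ 2 * (m j * r j ^+ 2)).
  apply: ler_sum => j _; rewrite prod_expectZ.
  have mj : forall n, (0 < n)%nat -> \sum_(k < d) m k * (k == j)%:R ^+ n = m j.
    move=> n n0; rewrite (bigD1 j) //= eqxx expr1n mulr1 big1 ?addr0 // => k /negPf ->.
    by rewrite expr0n gtn_eqF // mulr0.
  have := sq_bound (fun k => (k == j)%:R) (T%:R * q j).
  rewrite mj // (mj 1%nat) // => H.
  apply: le_trans (ler_wpM2l _ H) _.
    by rewrite divr_ge0 ?sqr_ge0 ?pavg_ge0.
  rewrite le_eqVlt; apply/orP; left; apply/eqP; rewrite /r; field.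
  exact: q_neq0.
have B2 : prod_expect p (fun x => (\sum_(t < T) r (x t) - T%:R * chi2 m q) ^+ 2) <=
    T%:R * \sum_(j < d) m j * r j ^+ 2.
  (* The centring constant is the exact mean, so the bias term vanishes. *)
  apply: le_trans (sq_bound r _) _.
  by rewrite -chi2_sum_dot subrr expr0n addr0.
apply: le_trans (lerD (ler_wpM2l _ B1) (ler_wpM2l _ B2)) _; rewrite ?sqr_ge0 //.
rewrite big_split /= -!mulr_sumr le_eqVlt; apply/orP; left; apply/eqP; ring.
Qed.


(** Termwise [(1 + r)^2 <= 2 + 2 r^2], and [c], an upper bound for every [1 / q j], turns [r^2] into
    a multiple of a chi-square term. *)
Lemma sum_sqr_add1_le c : (forall j, 1 <= c * q j) ->
  \sum_(j < d) (1 + r j) ^+ 2 <= 2 * d%:R + 2 * c * chi2 m q.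
Proof.
move=> cq; rewrite chi2_sum_sqr.
have -> : 2 * d%:R = \sum_(j < d) 2%:R :> R.
  by rewrite sumr_const card_ord mulr_natr.
rewrite mulr_sumr -big_split /=; apply: ler_sum => j _.
have H : r j ^+ 2 <= c * (q j * r j ^+ 2).
  by rewrite mulrA -[leLHS]mul1r ler_wpM2r ?sqr_ge0.
have -> : (1 + r j) ^+ 2 = 2 + 2 * r j ^+ 2 - (1 - r j) ^+ 2 by ring.
by have := sqr_ge0 (1 - r j); lra.
Qed.

(** Each term is [q j * r j ^+ 2 * (1 + r j)]. A single chi-square term is at most the whole sum,
    which forces [|r j| <= s]. *)
Lemma sum_pavg_sqr_le s : 0 <= s -> (forall j, chi2 m q <= s ^+ 2 * q j) ->
  \sum_(j < d) m j * r j ^+ 2 <= chi2 m q * (1 + s).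
Proof.
move=> s0 sq; rewrite {1}chi2_sum_sqr mulr_suml; apply: ler_sum => j _.
have -> : m j = q j * (1 + r j) by rewrite /r; field.
rewrite mulrAC; apply: ler_wpM2l; first by rewrite mulr_ge0 ?sqr_ge0 ?(ltW (q0 j)).
rewrite lerD2l.
apply: le_trans (ler_norm _) _; rewrite -(ler_pXn2r (ltn0Sn 1)) ?nnegrE //.
rewrite real_normK ?num_real // -(ler_pM2l (q0 j)) [leRHS]mulrC.
apply: le_trans (sq j); rewrite chi2_sum_sqr (bigD1 j) //= lerDl.
by apply: sumr_ge0 => k _; rewrite mulr_ge0 ?sqr_ge0 ?(ltW (q0 k)).
Qed.

Lemma chi2_ge0 : 0 <= chi2 m q.
Proof.
by rewrite chi2_sum_sqr; apply: sumr_ge0 => k _; rewrite mulr_ge0 ?sqr_ge0 ?(ltW (q0 k)).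
Qed.

(** Here [D] stands for [sqrt d] and [e] for [1 / K]; the last two hypotheses are the two
    sample-size conditions cleared of division. Each of the four variance terms then gains a factor
    [e] or [e ^+ 2] over [(T^2 M)^2]. *)
Lemma bilinear_stat_variance_le (D theta M e : R) :
  0 <= e -> 0 < theta -> theta <= M -> chi2 m q <= M ->
  D ^+ 2 = d%:R -> 1 <= D -> D <= e * (T%:R * theta) ->
  (forall j, 1 <= (e * T%:R) ^+ 2 * (theta * q j)) ->
  prod_expect p (fun x => prod_expect p (fun y =>
    (bilinear_stat x y - T%:R ^+ 2 * chi2 m q) ^+ 2)) <=
  (4 * e ^+ 2 + 4 * e) * (T%:R ^+ 2 * M) ^+ 2.
Proof.
move=> e0 th0 thM chiM Dd D1 DT eTq.
set t : R := T%:R; have t0 : 0 <= t by [].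
have chi0 := chi2_ge0.
have M0 : 0 <= M by lra.
have tM : t * theta <= t * M by rewrite ler_wpM2l.
have etM : D <= e * (t * M) by apply: le_trans DT _; rewrite ler_wpM2l.
(* [s := e T M] plays the role of [sqrt (chi2 m q / gamma)]. *)
have B1 := @sum_sqr_add1_le ((e * t) ^+ 2 * theta) _.
have B2 := @sum_pavg_sqr_le (e * (t * M)) _ _.
apply: le_trans bilinear_stat_variance _; rewrite -/t.
apply: le_trans (lerD (ler_wpM2l _ (B1 _)) (ler_wpM2l _ (B2 _ _))) _.
- by rewrite exprn_ge0.
- by move=> j; rewrite -mulrA.
- by rewrite mulr_ge0 ?exprn_ge0.
- by rewrite !mulr_ge0.
- move=> j; apply: le_trans chiM _.
  have -> : (e * (t * M)) ^+ 2 * q j = M * ((e * t) ^+ 2 * (M * q j)) by ring.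
  rewrite -[leLHS]mulr1; apply: ler_wpM2l => //; apply: le_trans (eTq j) _.
  by rewrite ler_wpM2l ?sqr_ge0 // ler_wpM2r // ltW.
have D2 : d%:R <= (e * (t * M)) ^+ 2.
  by rewrite -Dd; apply: lerXn2r => //; rewrite nnegrE; lra.
have P1 : theta * chi2 m q <= M ^+ 2 by rewrite expr2 ler_pM // ltW.
(* The term linear in [t * M] is absorbed using [1 <= D <= e * (t * M)]. *)
have P2 : t * chi2 m q <= e * (t * M) ^+ 2.
  apply: (@le_trans _ _ (t * M)); first by rewrite ler_wpM2l.
  have tM0 : 0 <= t * M by rewrite mulr_ge0.
  rewrite expr2 [leRHS]mulrA -[leLHS]mul1r; apply: ler_wpM2r => //; lra.
have P3 : t * chi2 m q * (e * (t * M)) <= e * (t * M) ^+ 2.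
  rewrite [leRHS](_ : _ = t * M * (e * (t * M))); last by ring.
  by rewrite ler_wpM2r ?mulr_ge0 // ler_wpM2l.
have P1' := ler_wpM2l (sqr_ge0 (e * t)) P1.
have -> : (4 * e ^+ 2 + 4 * e) * (t ^+ 2 * M) ^+ 2 =
  t ^+ 2 * (2 * (e * (t * M)) ^+ 2 + 2 * ((e * t) ^+ 2 * M ^+ 2)
    + 2 * (e * (t * M) ^+ 2) + 2 * (e * (t * M) ^+ 2)) by ring.
have -> : t ^+ 2 * (2 * d%:R + 2 * ((e * t) ^+ 2 * theta) * chi2 m q) +
    2 * t ^+ 3 * (chi2 m q * (1 + e * (t * M))) =
  t ^+ 2 * (2 * d%:R + 2 * ((e * t) ^+ 2 * (theta * chi2 m q))
    + 2 * (t * chi2 m q) + 2 * (t * chi2 m q * (e * (t * M)))) by ring.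
apply: ler_wpM2l; first exact: sqr_ge0.
by rewrite !lerD // ler_wpM2l.
Qed.

End Collision.

(** * Chebyshev's inequality and the threshold test *)

Lemma chebyshev (F : realFieldType) (S : finType) (P Z b : S -> F) (mu delta eps : F) :
  (forall x, 0 <= P x) -> 0 < delta ->
  (forall x, 0 <= b x <= 1) ->
  (forall x, b x != 0 -> delta <= `|Z x - mu|) ->
  \sum_x P x * (Z x - mu) ^+ 2 <= eps * delta ^+ 2 ->
  \sum_x P x * b x <= eps.
Proof.
(* Pointwise [b x * delta^2 <= (Z x - mu)^2], since [b x] is at most 1 and vanishes unless the
   deviation reaches [delta]. *)
move=> P0 d0 b01 bZ V; rewrite -(ler_pM2r (exprn_gt0 2 d0)).
apply: le_trans V; rewrite mulr_suml; apply: ler_sum => x _.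
rewrite -mulrA; apply: ler_wpM2l => //.
have [->|/bZ H] := eqVneq (b x) 0; first by rewrite mul0r sqr_ge0.
have /andP[_ b1] := b01 x.
apply: le_trans (ler_wpM2r (exprn_ge0 2 (ltW d0)) b1) _; rewrite mul1r.
rewrite -[leRHS]real_normK ?num_real //.
by apply: lerXn2r (H); rewrite nnegrE ?normr_ge0 // ltW.
Qed.

Lemma minq_gt0 d (q : 'I_d -> R) : (forall j, 0 < q j) -> 0 < minq q.
Proof. by move=> q0; apply/bigmin_gtP; split. Qed.

Lemma sum_sample_prob T d (p : 'I_T -> 'I_d -> R) :
  (forall t, is_distr (p t)) -> \sum_(x : sample_space T d) sample_prob p x = 1.
Proof.
move=> p1.
have p1' t : \sum_j p t j = 1 by case: (p1 t).
have := prod_expect_pair p (fun _ _ => 1).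
rewrite !prod_expect_const // => <-.
by apply: eq_bigr => x _; rewrite mulr1.
Qed.

Theorem theorem2p2 :
  exists K : R, 0 < K /\
  forall (d : nat) (q : 'I_d -> R) (theta : R) (T : nat),
    is_distr q ->
    (forall j, 0 < q j) ->
    0 < theta ->
    K * Num.max (Num.sqrt (d%:R) / theta)
                (Num.sqrt (theta * minq q))^-1 <= T%:R ->
    exists A : sample_space T d -> R,
      is_test A /\
      forall p : 'I_T -> 'I_d -> R,
        (forall t, is_distr (p t)) ->
        (chi2 (pavg p) q <= 99/100 * theta ->
           99/100 <= accept_prob A p) /\
        (theta < chi2 (pavg p) q ->
           99/100 <= 1 - accept_prob A p).
Proof.
(* With [e = 1 / K], [4 e^2 + 4 e] must be at most [1/100] (error probability) times [(1/200)^2]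
   (relative distance), that is [2.5 / 10^7]. *)
pose K := (10%:R : R) ^+ 8; have K0 : 0 < K by rewrite exprn_gt0.
exists K; split=> // d q theta T q1 q0 th0 HT.
pose D : R := Num.sqrt d%:R.
pose g : R := Num.sqrt (theta * minq q).
pose e := K^-1; have e0 : 0 < e by rewrite invr_gt0.
have eK : e * K = 1 by rewrite mulVf ?gt_eqF.
have gam0 := minq_gt0 q0.
have g0 : 0 < g by rewrite sqrtr_gt0 mulr_gt0.
have d0 : (0 < d)%nat.
  case: d q q1 {q0 HT D g gam0 g0} => // q [_].
  by rewrite big_ord0 => /esym/eqP; rewrite oner_eq0.
have Dd : D ^+ 2 = d%:R by rewrite sqr_sqrtr.
have D1 : 1 <= D by rewrite -sqrtr1 ler_wsqrtr // ler1n.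
have HT1 : D <= e * (T%:R * theta).
  have : K * (D / theta) <= T%:R.
    by apply: le_trans HT; rewrite ler_wpM2l ?(ltW K0) // le_max lexx.
  rewrite mulrA ler_pdivrMr // => /(ler_wpM2l (ltW e0)).
  by rewrite mulrA eK mul1r.
have HT2 : 1 <= e * T%:R * g.
  have : K * g^-1 <= T%:R.
    by apply: le_trans HT; rewrite ler_wpM2l ?(ltW K0) // le_max lexx orbT.
  rewrite ler_pdivrMr // => /(ler_wpM2l (ltW e0)).
  by rewrite eK mulrA.
have T0 : (0 < T)%nat.
  rewrite lt0n; apply/eqP => T0; move: HT2; rewrite T0 mulr0 mul0r.
  by rewrite ler10.
have HT3 j : 1 <= (e * T%:R) ^+ 2 * (theta * q j).
  apply: (@le_trans _ _ ((e * T%:R * g) ^+ 2)).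
    by rewrite exprn_ege1.
  rewrite exprMn sqr_sqrtr; last by rewrite mulr_ge0 // ltW.
  by rewrite ler_wpM2l ?sqr_ge0 // ler_pM2l // bigmin_le.
have eps : 4 * e ^+ 2 + 4 * e <= 1 / 100 * 200^-1 ^+ 2.
  (* Rescaling by [h] reduces the numerical claim to an inequality in [h] on [[0, 1]] with small
     coefficients. *)
  pose h := (10%:R : R) ^- 6.
  have eh : e = h * (1 / 100) by rewrite /e /K /h; field.
  have h0 : 0 <= h by rewrite invr_ge0 exprn_ge0.
  have h1 : h <= 1 by rewrite invf_le1 ?exprn_ege1 ?exprn_gt0 // ler1n.
  have -> : 1 / 100 * 200^-1 ^+ 2 = h * (1 / 4) by rewrite /h; field.
  rewrite eh; nra.
pose Z (z : sample_space T d) :=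
  bilinear_stat q [ffun t => (z t).1] [ffun t => (z t).2].
(* The factor [199/200] is the midpoint of [99/100] and 1. *)
pose tau := T%:R ^+ 2 * (199 / 200 * theta).
pose accept z := Z z <= tau.
exists (fun z => (accept z)%:R); split.
  by move=> z; rewrite ler0n lern1 leq_b1.
move=> p p1.
set chi := chi2 (pavg p) q.
pose M := Num.max theta chi.
have thM : theta <= M by rewrite le_max lexx.
have chiM : chi <= M by rewrite le_max lexx orbT.
have t2 : 0 < T%:R ^+ 2 :> R by rewrite exprn_gt0 // ltr0n.
pose delta := T%:R ^+ 2 * M / 200.
have delta0 : 0 < delta.
  by rewrite divr_gt0 // mulr_gt0 // (lt_le_trans th0).
have V : \sum_(z : sample_space T d) sample_prob p z *
    (Z z - T%:R ^+ 2 * chi) ^+ 2 <= 1 / 100 * delta ^+ 2.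
  rewrite (prod_expect_pair p (fun x y =>
    (bilinear_stat q x y - T%:R ^+ 2 * chi) ^+ 2)).
  apply: le_trans (bilinear_stat_variance_le q1 q0 T0 p1 (ltW e0) th0 thM chiM
    Dd D1 HT1 HT3) _.
  rewrite /delta expr_div_n [leRHS]mulrCA mulrC -exprVn.
  by apply: ler_wpM2l; rewrite ?sqr_ge0.
have P0 x : 0 <= sample_prob p x.
  by apply: prodr_ge0 => t _; case: (p1 t) => p0 _; rewrite mulr_ge0.
split=> Hchi.
- have -> : accept_prob (fun z => (accept z)%:R) p =
      1 - \sum_z sample_prob p z * (~~ accept z)%:R.
    rewrite -[X in X - _](sum_sample_prob p1) -sumrB; apply: eq_bigr => z _.
    by case: (accept z); rewrite /= ?mulr1n ?mulr0n ?mulr1 ?mulr0 ?subr0 ?subrr.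
  suff : \sum_z sample_prob p z * (~~ accept z)%:R <= 1 / 100 by lra.
  apply: chebyshev P0 delta0 _ _ V => z; first by rewrite ler0n lern1 leq_b1.
  rewrite /accept; case: leP => [|Zt _]; first by rewrite eqxx.
  (* A false rejection exceeds the mean by at least [T^2 (199/200 - 99/100) theta], which is
     [delta]. *)
  have ME : M = theta by apply/max_idPl; lra.
  apply: le_trans (ler_norm _); rewrite /delta ME.
  have := ler_wpM2l (ltW t2) Hchi; move: Zt; rewrite /tau; lra.
suff : accept_prob (fun z => (accept z)%:R) p <= 1 / 100 by lra.
apply: chebyshev P0 delta0 _ _ V => z; first by rewrite ler0n lern1 leq_b1.
rewrite /accept; case: leP => // [Zt _|]; last by rewrite eqxx.
(* As [theta < chi], the gap [chi - 199/200 theta] exceeds [chi / 200], so [delta] may grow with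
   [chi] as the variance bound does. *)
have ME : M = chi by apply/max_idPr; lra.
rewrite distrC; apply: le_trans (ler_norm _); rewrite /delta ME.
have := ler_wpM2l (ltW t2) (ltW Hchi); move: Zt; rewrite /tau; lra.
Qed.
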